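(* Let $I$ be a homogeneous prime ideal in $R=\mathbb{C}[x_0,\dots,x_n]$ and let $g_1,\dots,g_k$ be elements of $I$. Assume that for some term order $<$ on $R$: (1) the leading monomial $\mathrm{in}_<(g_i)$ is square-free for each $i$; (2) the ideal $J:=\langle \mathrm{in}_<(g_1),\dots,\mathrm{in}_<(g_k)\rangle$ is equidimensional; (3) $\dim J=\dim I$ and $\deg(J)=\deg(I)$. Then $\{g_1,\dots,g_k\}$ forms a Gröbner basis for $I$ with respect to $<$.
   Context: For a homogeneous ideal, $\dim$ and $\deg$ denote the dimension and the degree of the scheme it defines. An ideal is equidimensional if all its minimal primes have the same dimension. *)

(* Defs.v *)
From mathcomp Require Import all_boot all_order all_algebra.
From mathcomp Require Import boolp classical_sets reals.
From mathcomp Require Import complex mpoly.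

Set Implicit Arguments.
Unset Strict Implicit.
Unset Printing Implicit Defensive.

Import GRing.Theory.
Local Open Scope ring_scope.

Section Ideals.
Variables (n : nat) (F : fieldType).
Implicit Types (S I P Q : {pred {mpoly F[n.+1]}}).

(* [idealr_closed] includes properness. *)
Definition prime_ideal P : Prop := idealr_closed P /\ prime_idealr_closed P.

Definition ideal_gen (G : {mpoly F[n.+1]} -> Prop) : {pred {mpoly F[n.+1]}} :=
  fun f => `[< exists s : seq ({mpoly F[n.+1]} * {mpoly F[n.+1]}),
    (forall ag, ag \in s -> G ag.2) /\ f = \sum_(ag <- s) ag.1 * ag.2 >].

Definition homogeneous I : Prop :=
  forall f, f \in I -> forall d, pihomog mdeg d f \in I.

Definition minimal_prime I P : Prop :=
  [/\ prime_ideal P, {subset I <= P} &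
      forall Q, prime_ideal Q -> {subset I <= Q} -> {subset Q <= P} ->
        {subset P <= Q}].

(* The points of Proj (F[x] / I), as homogeneous primes of F[x]: those which
   contain I but not the irrelevant ideal. *)
Definition proj_point I P : Prop :=
  [/\ prime_ideal P, homogeneous P, {subset I <= P} & exists i, 'X_i \notin P].

Definition proj_chain I (c : nat) : Prop :=
  exists P : nat -> {pred {mpoly F[n.+1]}},
    (forall i, (i < c)%N -> proj_point I (P i)) /\
    (forall i, (i.+1 < c)%N ->
      {subset P i <= P i.+1} /\ ~ {subset P i.+1 <= P i}).

(* Krull dimension of Proj (F[x] / I).  A chain of c primes has length c - 1;
   the empty scheme has dimension -1. *)
Definition proj_dim I : int :=
  (supremum 0%N [set c | proj_chain I c])%:Z - 1.

Definition equidimensional I : Prop :=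
  forall P Q, minimal_prime I P -> minimal_prime I Q ->
    proj_dim P = proj_dim Q.

Definition graded_part I (t : nat) : {vspace dhomog n.+1 F t} :=
  xget 0%VS [set U : {vspace dhomog n.+1 F t} |
    forall f, (f \in U) = (val f \in I)].

(* The dimension over F of the degree t component of F[x] / I. *)
Definition hilbert_fun I (t : nat) : nat :=
  (\dim {:dhomog n.+1 F t} - \dim (graded_part I t))%N.

Definition hilbert_poly I : {poly rat} :=
  xget 0 [set p : {poly rat} | exists t0, forall t, (t0 <= t)%N ->
    p.[t%:R] = (hilbert_fun I t)%:R].

(* For the empty scheme hilbert_poly is 0, so the degree is 0. *)
Definition proj_deg I : rat :=
  `|proj_dim I|%N`!%:R * lead_coef (hilbert_poly I).

Definition term_order (le : rel 'X_{1..n.+1}) : Prop :=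
  [/\ total le, antisymmetric le, transitive le,
      forall m, le 0%MM m &
      forall m m1 m2, le m1 m2 -> le (m + m1)%MM (m + m2)%MM].

(* in_<(f), as a polynomial, with in_<(0) = 0. *)
Definition init_mon (le : rel 'X_{1..n.+1}) (f : {mpoly F[n.+1]}) : {mpoly F[n.+1]} :=
  if f == 0 then 0 else 'X_[last 0%MM (sort le (msupp f))].

(* In particular f is a monomial, hence nonzero. *)
Definition squarefree_mon (f : {mpoly F[n.+1]}) : Prop :=
  exists2 m : 'X_{1..n.+1}, f = 'X_[m] & forall i, (m i <= 1)%N.

Definition initial_ideal le (G : {mpoly F[n.+1]} -> Prop) : {pred {mpoly F[n.+1]}} :=
  ideal_gen (fun h => exists2 f, G f & h = init_mon le f).

Definition groebner_basis le I (G : {mpoly F[n.+1]} -> Prop) : Prop :=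
  (forall f, G f -> f \in I) /\
  initial_ideal le G =i initial_ideal le (fun f => f \in I).

End Ideals.

(* Main.v *)
From HB Require Import structures.
Require Import Defs.
From mathcomp Require Import all_boot all_order all_algebra.
From mathcomp Require Import boolp classical_sets reals.
From mathcomp Require Import complex mpoly.
From mathcomp Require Import zify lra.

(** Write [in(I)] for the set of leading monomials of elements of [I] and [e i] for
the leading monomial of [g i].  Every multiple of an [e i] lies in [in(I)]; the
theorem says that there are no further leading monomials.

Both sides have a Hilbert polynomial.  In degree [t] the quotient by [I] has a
basis indexed by the monomials outside [in(I)], and the quotient by [J] one
indexed by the monomials that are not multiples of any [e i]
([hilbert_fun_count], [hilbert_fun_monomial]).  Suppose that a monomial [a] of
[in(I)] is a multiple of no [e i].  As [J] is square-free it is an intersection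
of primes generated by variables, so some minimal prime [P] of [J], generated
by the variables of a set [S], does not contain [a] ([cover_avoiding]).  The
products of [a] with the monomials in the variables outside [S] then lie in
[in(I)] and not in [J].  Their number in degree [t] is the value of the Hilbert
function of [P] at [t - mdeg a], whose polynomial has size [s], the number of
variables outside [S].  Thus the difference of the Hilbert polynomials of [J]
and [I] has size at least [s] ([hilbert_fun_gap]).

On the other hand equidimensionality bounds the size of the Hilbert polynomial
of [J] by [s] ([size_hilbert_poly_monomial]), and equality of dimensions forces
that of [I] to have size at least [s].  So both have size [s], and equality of
degrees says that their leading coefficients agree, whence their difference has
size smaller than [s]: a contradiction ([leading_set_generated]).

The link between the dimension, defined by chains of primes, and the size of
the Hilbert polynomial needs only one inequality: passing to a strictly larger
homogeneous prime lowers the degree of the Hilbert polynomial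
([hilbert_poly_drop]), so a chain is no longer than the size of the polynomial
([proj_chain_le]).  For primes generated by variables an explicit chain of
the same length exists ([coord_prime_chain]), so equality holds there, and for
[J] and [I] one inequality each suffices.  That Hilbert polynomials exist is
shown combinatorially, for the complement of any up-closed set of monomials
([counts_upset]). *)

Set Implicit Arguments.
Unset Strict Implicit.
Unset Printing Implicit Defensive.
Import Order.TTheory GRing.Theory Num.Theory.
Local Open Scope ring_scope.

(** * Growth of polynomial counting functions *)

Section PolynomialGrowth.
Implicit Types (p q : {poly rat}) (h : nat -> nat).

Definition eventually (P : nat -> Prop) := exists t0, forall t, (t0 <= t)%N -> P t.

Lemma eventuallyI (P Q : nat -> Prop) :
  eventually P -> eventually Q -> eventually (fun t => P t /\ Q t).
Proof.
by move=> [a Pa] [b Qb]; exists (maxn a b) => t; rewrite geq_max => /andP[/Pa ? /Qb].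
Qed.

Lemma eventually_mono (P Q : nat -> Prop) :
  (forall t, P t -> Q t) -> eventually P -> eventually Q.
Proof. by move=> PQ [a Pa]; exists a => t /Pa/PQ. Qed.

Lemma eventually_ge (x : rat) : eventually (fun t => x <= t%:R).
Proof.
exists (Num.bound `|x|) => t le_t.
apply: le_trans (ler_norm _) _; apply/ltW/(lt_le_trans (archi_boundP _)) => //.
by rewrite ler_nat.
Qed.

(** Horner's rule: if [p = q * 'X + c] and [q] is eventually at least [1],
then [p] eventually dominates ['X + c]. *)
Lemma poly_unbounded p (M : rat) : (1 < size p)%N -> 0 < lead_coef p ->
  eventually (fun t => M <= p.[t%:R]).
Proof.
elim/poly_ind: p M => [|q c IH] M; first by rewrite size_poly0.
have [-> | q_neq0] := eqVneq q 0.
  by rewrite mul0r add0r => /leq_trans/(_ (size_polyC_leq1 _)).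
move=> _; rewrite lead_coefDl ?size_mulX ?(leq_ltn_trans (size_polyC_leq1 _)) //;
  last by rewrite ltnS lt0n size_poly_eq0.
rewrite lead_coefMX => lcq_gt0.
have [sq | sq] := leqP (size q) 1.
  have /size_poly1P[a a_neq0 qE] : size q == 1 by rewrite eqn_leq sq lt0n size_poly_eq0.
  move: lcq_gt0; rewrite qE lead_coefC => a_gt0.
  apply: eventually_mono (eventually_ge ((M - c) / a)) => t.
  by rewrite !hornerE -lerBlDr (mulrC a) -ler_pdivrMr.
apply: eventually_mono (eventuallyI (IH 1 sq lcq_gt0) (eventually_ge (M - c))) => t.
move=> [le1q]; rewrite !hornerE -lerBlDr => /le_trans; apply.
by rewrite ler_peMl.
Qed.

Lemma lead_coef_ge0 p : eventually (fun t => 0 <= p.[t%:R]) -> 0 <= lead_coef p.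
Proof.
move=> p_ge0; rewrite leNgt; apply/negP => lc_lt0.
have [sp | sp] := leqP (size p) 1.
  move: lc_lt0; rewrite (size1_polyC sp) lead_coefC => c_lt0.
  have [t0 /(_ _ (leqnn _))] := p_ge0.
  by rewrite (size1_polyC sp) hornerC leNgt c_lt0.
have : eventually (fun t => 1 <= (- p).[t%:R]).
  by apply: poly_unbounded; rewrite ?size_polyN // lead_coefN oppr_gt0.
move=> /(eventuallyI p_ge0)[t0 /(_ _ (leqnn _))[]].
by rewrite hornerN; lra.
Qed.

(** If [p] had larger size, it would determine the sign of the leading
coefficient of [q - p]. *)
Lemma size_le_of_le p q :
  eventually (fun t => 0 <= p.[t%:R]) -> eventually (fun t => p.[t%:R] <= q.[t%:R]) ->
  (size p <= size q)%N.
Proof.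
move=> p_ge0 le_pq; rewrite leqNgt; apply/negP => lt_qp.
have: 0 <= lead_coef (q - p).
  apply: lead_coef_ge0; apply: eventually_mono le_pq => t.
  by rewrite !hornerE subr_ge0.
rewrite addrC lead_coefDl ?size_polyN // lead_coefN oppr_ge0 => lc_le0.
have /eqP : lead_coef p == 0 by rewrite eq_le lc_le0 lead_coef_ge0.
by move/eqP; rewrite lead_coef_eq0 => /eqP p0; rewrite p0 size_poly0 in lt_qp.
Qed.

Lemma size_sub_lt p q : p != 0 -> size q = size p -> lead_coef q = lead_coef p ->
  (size (p - q)%R < size p)%N.
Proof.
move=> p_neq0 szE lcE; have sp : (0 < size p)%N by rewrite lt0n size_poly_eq0.
rewrite -(prednK sp) ltnS; apply/leq_sizeP => j.
rewrite leq_eqVlt => /predU1P[<- | lt_j]; rewrite coefB.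
  by move: lcE; rewrite /lead_coef szE => ->; rewrite subrr.
by rewrite !nth_default ?subrr ?szE // -(prednK sp).
Qed.

Lemma size_shift p (a : rat) : size (p \Po ('X + a%:P)) = size p.
Proof. by rewrite size_comp_poly2 // size_XaddC. Qed.

Lemma lead_coef_shift p (a : rat) : lead_coef (p \Po ('X + a%:P)) = lead_coef p.
Proof. by rewrite lead_coef_comp ?size_XaddC // lead_coefXaddC expr1n mulr1. Qed.

Lemma size_difference p (a : rat) : p != 0 -> (size (p - (p \Po ('X + a%:P)))%R < size p)%N.
Proof. by move=> p0; apply: size_sub_lt; rewrite ?size_shift ?lead_coef_shift. Qed.

(** The difference of ['X^d] has size [d] and leading coefficient [d], so
subtracting a multiple of it lowers the size of a polynomial of size [d]. *)
Lemma antidifference p : exists q, (q \Po ('X + 1)) - q = p.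
Proof.
have [m] := ubnP (size p); elim: m p => // m IH p; rewrite ltnS => sp.
have [-> | p_neq0] := eqVneq p 0; first by exists 0; rewrite comp_poly0 subrr.
pose d := size p; have d_gt0 : (0 < d)%N by rewrite lt0n size_poly_eq0.
have stepE : ('X + 1) ^+ d - 'X^d = \sum_(i < d) 'C(d, i)%:R *: 'X^i :> {poly rat}.
  rewrite ['X + 1]addrC exprDn big_ord_recr /= binn subnn expr0 mul1r mulr1n addrK.
  by apply: eq_bigr => i _; rewrite expr1n mul1r scaler_nat.
pose c := lead_coef p / d%:R.
have d_neq0 : d%:R != 0 :> rat by rewrite pnatr_eq0 -lt0n.
have [|q qE] := IH (p - c *: (('X + 1) ^+ d - 'X^d)).
  apply: leq_trans sp; apply: (@leq_ltn_trans d.-1); last by rewrite prednK.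
  apply/leq_sizeP => j le_dj.
  rewrite coefB coefZ stepE coef_sum.
  have [le_j|lt_j] := leqP d j.
    rewrite nth_default // big1 ?mulr0 ?subrr // => i _.
    by rewrite coefZ coefXn gtn_eqF ?mulr0 // (leq_trans (ltn_ord i)).
  have -> : j = d.-1 by apply/eqP; rewrite eqn_leq le_dj -ltnS (prednK d_gt0) lt_j.
  have lt_d : (d.-1 < d)%N by rewrite prednK.
  rewrite (bigD1 (Ordinal lt_d)) //= coefZ coefXn eqxx big1 => [|i].
    by rewrite addr0 mulr1 -subn1 bin_sub // bin1 /c divfK // lead_coefE subn1 subrr.
  by rewrite -val_eqE /= => ne_i; rewrite coefZ coefXn eq_sym (negPf ne_i) mulr0.
exists (q + c *: 'X^d).
rewrite comp_polyD comp_polyZ comp_Xn_poly.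
by rewrite opprD addrACA qE -scalerBr subrK.
Qed.

(** Polynomials are compared with counting functions only for large arguments,
where the latter are polynomial. *)
Definition counts h p := eventually (fun t => p.[t%:R] = (h t)%:R).

Lemma counts_ge0 h p : counts h p -> eventually (fun t => 0 <= p.[t%:R]).
Proof. by apply: eventually_mono => t ->. Qed.

Lemma countsD h1 h2 p1 p2 : counts h1 p1 -> counts h2 p2 ->
  counts (fun t => h1 t + h2 t)%N (p1 + p2).
Proof.
move=> c1 c2; apply: eventually_mono (eventuallyI c1 c2) => t [h1E h2E].
by rewrite hornerD h1E h2E natrD.
Qed.

Lemma counts_eq h1 h2 p : eventually (fun t => h1 t = h2 t) -> counts h1 p -> counts h2 p.
Proof.
by move=> e c; apply: eventually_mono (eventuallyI e c) => t [<-].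
Qed.

Lemma counts_delay h p e : counts h p ->
  counts (fun t => if (e <= t)%N then h (t - e)%N else 0%N) (p \Po ('X + (- e%:R)%:P)).
Proof.
case=> t0 hE; exists (t0 + e)%N => t le_t.
have le_et : (e <= t)%N by apply: leq_trans le_t; apply: leq_addl.
rewrite le_et horner_comp !hornerE -natrB // hE //.
by rewrite leq_subRL // addnC.
Qed.

Lemma counts_sum h p : counts h p -> exists q, counts (fun t => \sum_(k < t.+1) h k)%N q.
Proof.
case=> t0 hE; have [q qE] := antidifference p.
have stepE (x : rat) : q.[x + 1] - q.[x] = p.[x].
  by rewrite -qE hornerD hornerN horner_comp hornerD hornerX hornerC.
pose c := (\sum_(k < t0) h k)%N%:R - q.[t0%:R].
have sumE t : (t0 <= t)%N -> (\sum_(k < t) h k)%N%:R = q.[t%:R] + c.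
  move=> /subnK <-; elim: (t - t0)%N => [|u IH]; first by rewrite add0n /c addrC subrK.
  rewrite addSn big_ord_recr natrD IH -hE ?leq_addl // -stepE -natr1.
  by rewrite addrC addrA subrK.
exists ((q \Po ('X + 1%:P)) + c%:P), t0 => t le_t.
rewrite sumE ?(leq_trans le_t) // hornerD hornerC horner_comp hornerD hornerX hornerC.
by rewrite natr1.
Qed.

Lemma size_counts_le h1 h2 p1 p2 : counts h1 p1 -> counts h2 p2 ->
  eventually (fun t => h1 t <= h2 t)%N -> (size p1 <= size p2)%N.
Proof.
move=> c1 c2 le12; apply: size_le_of_le (counts_ge0 c1) _.
apply: eventually_mono (eventuallyI c1 (eventuallyI c2 le12)) => t [-> [-> ?]].
by rewrite ler_nat.
Qed.

End PolynomialGrowth.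

(** * Complements of up-closed sets of exponent vectors *)

Section Monomials.
Local Open Scope nat_scope.
Implicit Types (A : pred (seq nat)) (s : seq nat).

(** Exponent vectors of length [n] and sum [t], split by their first entry so
that counting arguments can proceed by induction on the number of variables. *)
Fixpoint mons (n t : nat) : seq (seq nat) :=
  if n is m.+1 then flatten [seq [seq k :: s | s <- mons m (t - k)] | k <- iota 0 t.+1]
  else if t == 0 then [:: [::]] else [::].

Lemma monsS n t :
  mons n.+1 t = flatten [seq [seq k :: s | s <- mons n (t - k)] | k <- iota 0 t.+1].
Proof. by []. Qed.

Lemma mem_mons n t s : (s \in mons n t) = (size s == n) && (sumn s == t).
Proof.
elim: n t s => [|n IH] t s.
  rewrite /=; case: eqP => [->|t0]; rewrite inE; first by case: s.
  by case: s => //=; rewrite eq_sym; move/eqP/negPf: t0.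
rewrite monsS; case: s => [|k s]; first by apply/flatten_mapP => -[i _ /mapP[]].
rewrite [size _]/= eqSS [sumn _]/=; apply/flatten_mapP/andP.
  case=> i; rewrite mem_iota add0n ltnS /= => le_it /mapP[s' s'_in [-> ->]].
  by move: s'_in; rewrite IH => /andP[-> /eqP->]; split; rewrite ?subnKC.
move=> [/eqP sz /eqP sE]; exists k; first by rewrite mem_iota -sE add0n ltnS leq_addr.
by apply/mapP; exists s; rewrite // IH sz -sE addKn !eqxx.
Qed.

Lemma uniq_mons n t : uniq (mons n t).
Proof.
elim: n t => [|n IH] t; first by rewrite /=; case: ifP.
rewrite monsS; have: uniq (iota 0 t.+1) by apply: iota_uniq.
elim: (iota 0 t.+1) => //= k l IHl /andP[k_l /IHl u].
rewrite cat_uniq u map_inj_uniq ?IH ?andbT => [|? ? []//] /=.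
apply/hasP => -[_ /flatten_mapP[k' k'_l /mapP[s _ ->]] /mapP[s' _ [kE _]]].
by rewrite -kE k'_l in k_l.
Qed.

Lemma count_mons A n t :
  count A (mons n.+1 t) = (\sum_(k < t.+1) count (fun s => A (val k :: s)) (mons n (t - k))).
Proof.
rewrite monsS count_flatten sumnE !big_map.
have -> : iota 0 t.+1 = index_iota 0 t.+1 by rewrite /index_iota subn0.
rewrite big_mkord.
by apply: eq_bigr => k _; rewrite count_map.
Qed.

(** The exponent vectors of a monomial ideal, for vectors of length [n]. *)
Definition upset n A := forall s s', size s = n -> all2 leq s s' -> A s -> A s'.

Lemma all2_leq_refl s : all2 leq s s.
Proof. by elim: s => //= k s ->; rewrite leqnn. Qed.

Lemma upset_slice n A k : upset n.+1 A -> upset n (fun s => A (k :: s)).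
Proof. by move=> upA s s' sz le_s; apply: upA => /=; rewrite ?sz // leqnn. Qed.

Lemma upset_slice_le n A k k' s : upset n.+1 A -> size s = n -> (k <= k')%N ->
  A (k :: s) -> A (k' :: s).
Proof.
by move=> upA sz le_k; apply: upA => /=; rewrite ?sz // le_k all2_leq_refl.
Qed.

Lemma chain_le n (U : nat -> pred (seq nat)) :
  (forall k s, size s = n -> U k s -> U k.+1 s) ->
  forall j k s, (j <= k)%N -> size s = n -> U j s -> U k s.
Proof.
move=> incU j k s /subnK <- sz Uj; elim: (k - j)%N => // i IH.
by rewrite addSn; apply: incU.
Qed.

(** The ascending chain condition for monomial ideals.  Slice by the first
coordinate: the diagonal slices stabilize by induction, at [K0] say, and by
monotonicity in both indices this settles all slices of index at least [K0] at
once; the finitely many remaining slices are handled one by one. *)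
Lemma upset_chain_stabilizes n (U : nat -> pred (seq nat)) :
  (forall k, upset n (U k)) -> (forall k s, size s = n -> U k s -> U k.+1 s) ->
  exists K, forall k s, (K <= k)%N -> size s = n -> U k s = U K s.
Proof.
elim: n U => [|n IH] U upU incU.
  have [[K UK]|noU] := pselect (exists k, U k [::]).
    exists K => k s le_k /size0nil ->; rewrite UK.
    exact: (chain_le incU le_k).
  exists 0%N => k s _ /size0nil ->.
  by apply/idP/idP => Us; case: noU; [exists k | exists 0%N].
have [|k s sz Uk|K0 K0P] := IH (fun k s => U k (k :: s)).
- by move=> k; apply: upset_slice.
- apply: (@upset_slice_le n _ k) => //; apply: incU => //=; by rewrite sz.
(* Both indices can be raised to a common value on the diagonal. *)
have tailU i j s : (K0 <= i)%N -> (K0 <= j)%N -> size s = n -> U j (i :: s) = U K0 (K0 :: s).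
  move=> le_i le_j sz; apply/idP/idP => [Uji|U0]; last first.
    apply: (upset_slice_le _ _ le_i) => //.
    by apply: (chain_le incU le_j) => //=; rewrite sz.
  rewrite -(K0P (maxn i j)) ?(leq_trans le_i) ?leq_maxl //.
  apply: (@upset_slice_le n _ i) => //; rewrite ?leq_maxl //.
  by apply: (chain_le incU (leq_maxr i j)) => //=; rewrite sz.
have headU b : exists K, forall i k s, (i < b)%N -> (K <= k)%N -> size s = n ->
    U k (i :: s) = U K (i :: s).
  elim: b => [|b [K KP]]; first by exists 0%N.
  have [|k s sz|K' K'P] := IH (fun k s => U k (b :: s)).
  - by move=> k; apply: upset_slice.
  - by apply: incU; rewrite /= sz.
  exists (maxn K K') => i k s; rewrite ltnS leq_eqVlt geq_max.
  move=> /predU1P[-> | lt_i] /andP[le_k le'_k] sz.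
    by rewrite K'P // -(K'P (maxn K K')) ?leq_maxr.
  by rewrite KP // -(KP i (maxn K K')) ?leq_maxl.
have [K KP] := headU K0.
exists (maxn K K0) => k [|i s]; rewrite ?geq_max //= => /andP[le_k le0_k] [sz].
have [lt_i|le_i] := ltnP i K0; last by rewrite !tailU ?leq_maxr.
by rewrite KP // -(KP i (maxn K K0)) ?leq_maxl.
Qed.

Lemma counts_finite_sum (h : nat -> nat -> nat) K :
  (forall k, exists p, counts (h k) p) ->
  exists p, counts (fun t => \sum_(k < K) if (k <= t)%N then h k (t - k) else 0)%N p.
Proof.
move=> hP; elim: K => [|K [p pP]].
  by exists 0%R; exists 0%N => t _; rewrite big_ord0 horner0.
have [q qP] := hP K; exists (p + (q \Po ('X + (- K%:R)%:P)))%R.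
apply: counts_eq (countsD pP (counts_delay K qP)).
by exists 0%N => t _; rewrite big_ord_recr.
Qed.

(** The slices of an up-closed set increase, hence are constant from some [K] on.
So the count in degree [t] is a sum of [K] delayed counting functions in one
variable less, plus a delayed sum of the values of one such function. *)
Lemma counts_upset n A : upset n A ->
  exists p, counts (fun t => count (predC A) (mons n t)) p.
Proof.
elim: n A => [|n IH] A upA; first by exists 0%R; exists 1%N => -[] // t _; rewrite horner0.
pose h k t := count (predC (fun s => A (k :: s))) (mons n t).
have hP k : exists p, counts (h k) p by apply/IH/upset_slice.
have [|k s sz|K KP] := @upset_chain_stabilizes n (fun k s => A (k :: s)).
- by move=> k; apply: upset_slice.
- exact: (upset_slice_le upA sz).
have [p pP] := counts_finite_sum K hP.
have [q /counts_sum[q' q'P]] := hP K.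
exists (p + (q' \Po ('X + (- K%:R)%:P)))%R.
apply: counts_eq (countsD pP (counts_delay K q'P)).
exists K => t le_t; rewrite le_t count_mons.
rewrite (eq_bigr (fun k : 'I_t.+1 => h k (t - k))) //.
rewrite -(big_mkord xpredT (fun k => h k (t - k))).
rewrite (@big_cat_nat _ _ _ K) //=; last by rewrite leqW.
rewrite big_mkord; congr (_ + _)%N.
  by apply: eq_bigr => k _; rewrite ltnW // (leq_trans (ltn_ord k)).
rewrite -[in RHS](add0n K) big_addn subSn // big_mkord (reindex_inj rev_ord_inj) /=.
apply: eq_bigr => i _; rewrite subSS addnC subnDA /h.
apply: eq_in_count => s; rewrite mem_mons => /andP[/eqP sz _] /=.
by rewrite KP // leq_addr.
Qed.

Definition avoids (b : seq bool) s := all2 (fun bi si => bi || (si == 0)%N) b s.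

(** All but one of the marked exponents, each at most [t], determine the last one. *)
Lemma count_avoids_le n b t : size b = n ->
  (count (avoids b) (mons n t) <= if count id b is c.+1 then t.+1 ^ c else t == 0)%N.
Proof.
elim: n b t => [|n IH] [|b0 b] // t; first by case: t.
move=> [sz]; rewrite count_mons; case: b0 => /=; last first.
  rewrite big_ord_recl /= subn0 big1 ?addn0 => [|i _]; first exact: IH.
  by rewrite count_pred0.
have {}IH u := IH b u sz; case: (count id b) IH => [|c] IH /=.
  apply: (@leq_trans (\sum_(k < t.+1) (t - k == 0))).
    by apply: leq_sum => k _; apply: IH.
  rewrite expn0 big_ord_recr /= subnn eqxx big1 // => k _.
  by rewrite subn_eq0 leqNgt ltn_ord.
rewrite expnS -[X in _ <= X * _](card_ord t.+1) -sum_nat_const.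
apply: leq_sum => k _; apply: leq_trans (IH (t - k)) _.
by case: (c) => // d; rewrite leq_exp2r // ltnS leq_subr.
Qed.

End Monomials.

(** * Leading monomials and dimensions *)

Section LeadingMonomials.
Variables (n : nat) (F : fieldType) (le : rel 'X_{1..n.+1}).
Hypothesis le_order : term_order le.
Implicit Types (m : 'X_{1..n.+1}) (I : {pred {mpoly F[n.+1]}}).

Definition leading (f : {mpoly F[n.+1]}) m := m \in msupp f /\ {in msupp f, forall m', le m' m}.

(** Valued in the regular module, so that a coefficient is a linear form. *)
Definition coef_at t m (f : dhomog n.+1 F t) : F^o := (val f)@_m.

Lemma coef_at_linear t m : linear (@coef_at t m).
Proof. by move=> a f g; rewrite /coef_at /= mcoeffD mcoeffZ. Qed.

HB.instance Definition _ t m :=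
  GRing.isLinear.Build F (dhomog n.+1 F t) F^o _ (@coef_at t m) (@coef_at_linear t m).

Lemma dimv_regular_le1 (U : {vspace F^o}) : (\dim U <= 1)%N.
Proof. by apply: leq_trans (dimvS (subvf U)) _; rewrite dimvf. Qed.

(** Go through the monomials in decreasing order: imposing the vanishing of the
coefficient at the largest monomial [m] lowers the dimension of [V] by one
exactly when [m] is a leading monomial, and keeps all other leading monomials. *)
Lemma dim_count_leading t (V : {vspace dhomog n.+1 F t}) (L : seq 'X_{1..n.+1}) :
  uniq L -> pairwise (fun x y => le y x) L ->
  (forall f, f \in V -> {subset msupp (val f) <= L}) ->
  \dim V = count (fun m => `[< exists2 f, f \in V & leading (val f) m >]) L.
Proof.
elim: L V => [|m L IH] V /= uL sL suppV.
  apply/eqP; rewrite dimv_eq0 -subv0; apply/subvP => f /suppV sub0.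
  rewrite memv0 -val_eqE /= -msupp_eq0.
  by case: (msupp _) sub0 => // m l /(_ m (mem_head _ _)).
move: uL sL => /andP[m_L uL] /andP[/allP mL sL].
(* The kernel of this form consists of the elements without the monomial m. *)
pose phi := linfun (@coef_at t m).
have in_ker f : (f \in (V :&: lker phi)%VS) = (f \in V) && (m \notin msupp (val f)).
  by rewrite memv_cap memv_ker lfunE /= mcoeff_msupp negbK.
rewrite -(limg_ker_dim phi V) addnC; congr (_ + _)%N; last first.
  rewrite IH // => [|f]; last first.
    rewrite in_ker => /andP[fV m_f] m' m'_f; have := suppV f fV m' m'_f.
    by rewrite inE => /predU1P[m'E|//]; rewrite -m'E m'_f in m_f.
  apply: eq_in_count => m' m'L; apply/asboolP/asboolP => -[f].
    by rewrite in_ker => /andP[fV _]; exists f.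
  move=> fV [m'f lef]; exists f => //; rewrite in_ker fV /=.
  apply/negP => /lef le_m; have := mL _ m'L => ge_m.
  have [_ anti _ _ _] := le_order.
  by move: m_L; rewrite (anti m m') ?m'L // le_m.
case: asboolP => [[f fV [mf _]]|no_lead].
  apply/eqP; rewrite eqn_leq dimv_regular_le1 lt0n dimv_eq0.
  apply/eqP => im0; have : phi f \in (phi @: V)%VS by apply: memv_img.
  by rewrite im0 memv0 lfunE /= /coef_at mcoeff_eq0 mf.
apply/eqP; rewrite dimv_eq0 -subv0; apply/subvP => _ /memv_imgP[f fV ->].
rewrite lfunE /= memv0 /coef_at mcoeff_eq0; apply/negP => mf; apply: no_lead.
exists f => //; split => // m' /(suppV f fV).
have [tot _ _ _ _] := le_order.
by rewrite inE => /predU1P[->|/mL //]; have := tot m m; rewrite orbb.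
Qed.

(** A subspace contained in [P] of the largest possible dimension is all of [P]. *)
Lemma subspace_exists (V : vectType F) (P : V -> Prop) :
  P 0 -> (forall a u v, P u -> P v -> P (a *: u + v)) ->
  exists U : {vspace V}, forall v, v \in U <-> P v.
Proof.
move=> P0 PD.
pose dims d := `[< exists2 U : {vspace V}, \dim U = d & forall v, v \in U -> P v >].
have dims_ex : exists d, dims d.
  exists 0%N; apply/asboolP; exists 0%VS; first exact: dimv0.
  by move=> v; rewrite memv0 => /eqP ->.
have dims_le d : dims d -> (d <= \dim {:V})%N.
  by move=> /asboolP[U <- _]; apply/dimvS/subvf.
case: (ex_maxnP dims_ex dims_le) => d /asboolP[U <- PU] maxU.
exists U => v; split=> [|Pv]; first exact: PU.
have PUv w : w \in (U + <[v]>)%VS -> P w.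
  move=> /memv_addP[u uU [_ /vlineP[a ->] ->]].
  by rewrite addrC; apply: PD => //; apply: PU.
have /eqP -> : U == (U + <[v]>)%VS.
  rewrite eqEdim addvSl; apply: maxU; apply/asboolP.
  by exists (U + <[v]>)%VS.
exact/(subvP (addvSr _ _))/memv_line.
Qed.

Definition mnm_of (s : seq nat) : 'X_{1..n.+1} := [multinom nth 0%N s i | i < n.+1].

Definition degree_mons t := [seq mnm_of s | s <- mons n.+1 t].

Lemma mnm_ofK m : mnm_of m = m.
Proof. by apply/mnmP => i; rewrite mnmE -tnth_nth. Qed.

Lemma mnm_of_inj : {in [pred s | size s == n.+1] &, injective mnm_of}.
Proof.
move=> s s' /eqP sz /eqP sz' /mnmP e; apply: (@eq_from_nth _ 0%N); first by rewrite sz.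
by move=> i; rewrite sz => lti; have := e (Ordinal lti); rewrite !mnmE.
Qed.

Lemma mem_degree_mons t m : (m \in degree_mons t) = (mdeg m == t).
Proof.
apply/mapP/eqP => [[s]|degm]; last first.
  exists (val (multinom_val m)); last by rewrite [RHS]mnm_ofK.
  by rewrite mem_mons size_tuple eqxx /= sumnE -degm.
rewrite mem_mons => /andP[/eqP sz /eqP <-] ->.
rewrite mdegE sumnE (big_nth 0%N) big_mkord sz.
by apply: eq_bigr => i _; rewrite mnmE.
Qed.

Lemma uniq_degree_mons t : uniq (degree_mons t).
Proof.
rewrite map_inj_in_uniq ?uniq_mons // => s s'.
rewrite !mem_mons => /andP[sz _] /andP[sz' _]; exact: mnm_of_inj.
Qed.

End LeadingMonomials.

(** * Hilbert polynomials and the dimension of the projective scheme *)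

Section Ideals.
Variables (n : nat) (F : fieldType).
Implicit Types (m : 'X_{1..n.+1}) (I P : {pred {mpoly F[n.+1]}}).

(** Unlike [idealr_closed], this allows the unit ideal. *)
Definition ideal I := 0 \in I /\ forall a u v, u \in I -> v \in I -> a * u + v \in I.

Lemma ideal_prime P : prime_ideal P -> ideal P.
Proof. by move=> [[P0 _ PD] _]; split=> // a u v; apply: PD. Qed.

Lemma ideal_gen_ideal (G : {mpoly F[n.+1]} -> Prop) : ideal (ideal_gen G).
Proof.
split; first by apply/asboolP; exists [::]; rewrite big_nil.
move=> a u v /asboolP[su [suG ->]] /asboolP[sv [svG ->]]; apply/asboolP.
exists ([seq (a * ag.1, ag.2) | ag <- su] ++ sv); split=> [ag|].
  by rewrite mem_cat => /orP[/mapP[bg /suG bgG ->]|/svG].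
rewrite big_cat big_map mulr_sumr; congr (_ + _).
by apply: eq_bigr => ag _; rewrite mulrA.
Qed.

Lemma idealM I a u : ideal I -> u \in I -> a * u \in I.
Proof. by move=> [I0 ID] uI; rewrite -[a * u]addr0 ID. Qed.

Lemma idealD I u v : ideal I -> u \in I -> v \in I -> u + v \in I.
Proof. by move=> [I0 ID] uI vI; rewrite -[u]mul1r ID. Qed.

Lemma idealZ I (c : F) u : ideal I -> u \in I -> c *: u \in I.
Proof. by move=> idI uI; rewrite -mul_mpolyC idealM. Qed.

Lemma ideal_sum I (T : Type) (r : seq T) (A : pred T) (u : T -> {mpoly F[n.+1]}) :
  ideal I -> (forall i, A i -> u i \in I) -> \sum_(i <- r | A i) u i \in I.
Proof.
move=> idI uI; apply: (big_ind (fun f => f \in I)) => // [|x y]; first by case: idI.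
exact: idealD.
Qed.

Lemma ideal_genP (G : {mpoly F[n.+1]} -> Prop) I :
  ideal I -> (forall f, G f -> f \in I) -> {subset ideal_gen G <= I}.
Proof.
move=> idI GI f /asboolP[s [sG ->]]; rewrite big_seq.
by apply: ideal_sum => // ag /sG/GI; apply: idealM.
Qed.

Lemma mem_ideal_gen (G : {mpoly F[n.+1]} -> Prop) f : G f -> f \in ideal_gen G.
Proof.
move=> Gf; apply/asboolP; exists [:: (1, f)].
by split=> [ag|]; rewrite ?big_seq1 ?mul1r // inE => /eqP ->.
Qed.

Lemma prime_ideal_exp P f d : prime_ideal P -> f ^+ d \in P -> f \in P.
Proof.
move=> [[_ P1 _] Pmul]; elim: d => [|d IH]; first by rewrite expr0 (negPf P1).
by rewrite exprS => /Pmul/orP[|/IH].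
Qed.

Lemma mem_graded_part I t (f : dhomog n.+1 F t) :
  ideal I -> (f \in graded_part I t) = (val f \in I).
Proof.
move=> idI; rewrite /graded_part; case: xgetP => [U _ UI|noU]; first exact: UI.
have [||U UI] := @subspace_exists F (dhomog n.+1 F t) (fun f => val f \in I).
- by rewrite raddf0; case: idI.
- by move=> a u v uI vI; rewrite linearP idealD ?idealZ.
case: (noU U) => g; apply/idP/idP => /UI //.
Qed.

Lemma hilbert_fun_dim I t :
  (hilbert_fun I t + \dim (graded_part I t) = \dim {:dhomog n.+1 F t})%N.
Proof. by rewrite subnK // dimvS // subvf. Qed.

Lemma hilbert_fun_le I I' t : ideal I -> ideal I' -> {subset I <= I'} ->
  (hilbert_fun I' t <= hilbert_fun I t)%N.
Proof.
move=> idI idI' sub; apply/leq_sub2l/dimvS/subvP => f.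
by rewrite !mem_graded_part //; apply: sub.
Qed.

Section LeadingSet.
Variable le : rel 'X_{1..n.+1}.
Hypothesis le_order : term_order le.

Lemma leadingX m : leading (F := F) le 'X_[m] m.
Proof.
have [tot _ _ _ _] := le_order.
split=> [|m']; rewrite msuppX mem_seq1 // => /eqP->.
by have := tot m m; rewrite orbb.
Qed.

Lemma leading_mulX (f : {mpoly F[n.+1]}) m m' : leading le f m -> leading le (f * 'X_[m']) (m + m')%MM.
Proof.
have [_ _ _ _ leD] := le_order.
move=> [mf lef]; split; first by rewrite (perm_mem (msuppMX _ _)) addmC map_f.
move=> x; rewrite (perm_mem (msuppMX _ _)) => /mapP[y yf ->].
by rewrite [X in le _ X]addmC leD // lef.
Qed.

(** Using homogeneous elements only makes this set meaningful degree by degree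
for every ideal: it sees the largest homogeneous ideal contained in [I], as
does the Hilbert function. *)
Definition leading_set I m :=
  `[< exists2 f, f \in I & f \is (mdeg m).-homog /\ leading le f m >].

Lemma leading_set_mul I m m' : ideal I ->
  leading_set I m -> leading_set I (m + m')%MM.
Proof.
move=> idI /asboolP[f fI [fh fm]]; apply/asboolP; exists (f * 'X_[m']).
  by rewrite mulrC idealM.
by split; [rewrite mdegD dhomogM // dhomogX | apply: leading_mulX].
Qed.

Lemma upset_leading_set I : ideal I -> upset n.+1 (fun s => leading_set I (mnm_of n s)).
Proof.
move=> idI s s' sz le_s lead_s.
have sz' : size s' = n.+1 by rewrite -sz; move: le_s; rewrite all2E => /andP[/eqP].
suff -> : mnm_of n s' = (mnm_of n s + (mnm_of n s' - mnm_of n s))%MM.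
  exact: leading_set_mul.
apply/mnmP => i; rewrite !mnmE subnKC //.
move: le_s; rewrite all2E => /andP[_ /allP le_s].
have := le_s (nth 0%N s i, nth 0%N s' i); rewrite /= -nth_zip ?sz //; apply.
by rewrite mem_nth // size_zip sz sz' minnn.
Qed.

(** Macaulay's theorem: the monomials that are not leading monomials give a basis
of the quotient. *)
Lemma hilbert_fun_count I t : ideal I ->
  hilbert_fun I t = count (predC (leading_set I)) (degree_mons n t).
Proof.
move=> idI; have [tot anti trans _ _] := le_order.
pose L := sort (fun x y => le y x) (degree_mons n t).
have pL : perm_eq L (degree_mons n t) by rewrite perm_sort.
have uL : uniq L by rewrite (perm_uniq pL) uniq_degree_mons.
have sL : pairwise (fun x y => le y x) L.
  rewrite -sorted_pairwise => [|x y z]; last by move=> yx zy; apply: trans zy yx.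
  by apply: sort_sorted => x y; apply: tot.
have memL m : (m \in L) = (mdeg m == t) by rewrite (perm_mem pL) mem_degree_mons.
have suppL (f : dhomog n.+1 F t) : {subset msupp (val f) <= L}.
  by move=> m; rewrite memL => /(dhomogP _ _ _ (valP f)) ->.
have dimE V := @dim_count_leading n F le le_order t V L uL sL (fun f _ => suppL f).
rewrite /hilbert_fun !dimE -(permP pL).
have -> : count (fun m => `[< exists2 f, f \in graded_part I t & leading le (val f) m >]) L
    = count (leading_set I) L.
  apply: eq_in_count => m; rewrite memL => /eqP mt; apply/asboolP/asboolP => -[f].
    by rewrite mem_graded_part // => fI lf; exists (val f) => //; rewrite mt (valP f).
  by rewrite mt => fI [fh lf]; exists (DHomog fh); rewrite ?mem_graded_part.
have -> : count (fun m => `[< exists2 f, f \in {:dhomog n.+1 F t}%VS & leading le (val f) m >]) L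
    = size L.
  apply/eqP; rewrite -all_count; apply/allP => m.
  rewrite memL => /eqP mt; apply/asboolP.
  have Xh : ('X_[m] : {mpoly F[n.+1]}) \is t.-homog by rewrite dhomogX; apply/eqP.
  by exists (DHomog Xh); rewrite ?memvf //=; apply: leadingX.
by rewrite -(count_predC (leading_set I)) addKn.
Qed.

End LeadingSet.


(** The graded lexicographic order. *)
Lemma term_order_exists : exists le : rel 'X_{1..n.+1}, term_order le.
Proof.
exists (fun x y => (x <= y)%O); split.
- exact: le_total.
- exact: le_anti.
- exact: le_trans.
- by move=> m; apply: le0m.
- by move=> m m1 m2; rewrite lemc_add2r.
Qed.

(** Any term order turns the Hilbert function into the counting function of the
complement of an up-closed set of monomials. *)
Lemma hilbert_polyP I : ideal I -> counts (hilbert_fun I) (hilbert_poly I).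
Proof.
move=> idI; have [le le_order] := term_order_exists.
have [p pP] := counts_upset (upset_leading_set le_order idI).
apply: (@xgetPex _ 0 [set q | counts (hilbert_fun I) q]); exists p.
apply: counts_eq pP; exists 0%N => t _.
by rewrite (hilbert_fun_count le_order) // count_map.
Qed.

Lemma size_hilbert_poly_le I I' : ideal I -> ideal I' -> {subset I <= I'} ->
  (size (hilbert_poly I') <= size (hilbert_poly I))%N.
Proof.
move=> idI idI' sub; apply: size_counts_le (hilbert_polyP idI') (hilbert_polyP idI) _.
by exists 0%N => t _; apply: hilbert_fun_le.
Qed.

Section HomogeneousMultiplication.
Variables (e u : nat) (f : {mpoly F[n.+1]}).
Hypothesis f_homog : f \is e.-homog.

Lemma mul_homog_subproof (g : dhomog n.+1 F u) : f * val g \is (e + u).-homog.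
Proof. by apply: dhomogM => //; apply: valP. Qed.

Definition mul_homog (g : dhomog n.+1 F u) : dhomog n.+1 F (e + u) :=
  DHomog (mul_homog_subproof g).

Lemma mul_homog_linear : linear mul_homog.
Proof. by move=> a g h; apply/val_inj; rewrite /= mulrDr -scalerAr. Qed.

HB.instance Definition _ := GRing.isLinear.Build F _ _ _ mul_homog mul_homog_linear.

(** As [P] is prime and does not contain [f], multiplication by [f] induces an
injection of the quotient by [P] into itself, of degree [e], whose image
consists of classes that vanish modulo [I]. *)
Lemma hilbert_fun_drop P I : prime_ideal P -> ideal I -> {subset P <= I} ->
  f \in I -> f \notin P ->
  (hilbert_fun I (e + u) + hilbert_fun P u <= hilbert_fun P (e + u))%N.
Proof.
move=> P_prime idI sub fI fP; have idP := ideal_prime P_prime.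
pose mu := linfun mul_homog.
have muE g : mu g = mul_homog g by rewrite lfunE.
have mu_inj : lker mu == 0%VS.
  rewrite -subv0; apply/subvP => g; rewrite memv_ker muE memv0.
  move=> /eqP/(congr1 val) fg0; have /eqP : f * val g = 0 by [].
  rewrite mulf_eq0 => /orP[/eqP f0|/eqP g0]; last by apply/eqP/val_inj.
  by case: idP => P0 _; rewrite f0 P0 in fP.
have mu_dim V : \dim (mu @: V) = \dim V by rewrite limg_dim_eq // (eqP mu_inj) capv0.
set W0 := graded_part P (e + u); set U0 := graded_part P u.
have sub1 : (mu @: fullv + W0 <= graded_part I (e + u))%VS.
  rewrite subv_add; apply/andP; split; apply/subvP.
    by move=> _ /memv_imgP[g _ ->]; rewrite mem_graded_part // muE; rewrite [\val _]mulrC idealM.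
  by move=> g; rewrite !mem_graded_part //; apply: sub.
have sub2 : (mu @: fullv :&: W0 <= mu @: U0)%VS.
  apply/subvP => _ /memv_capP[/memv_imgP[g _ ->]].
  rewrite mem_graded_part // muE => fgP; rewrite -muE memv_img //.
  rewrite mem_graded_part //; case: P_prime => _ Pmul.
  by case/orP: (Pmul _ _ fgP) => //; rewrite (negPf fP).
have := hilbert_fun_dim I (e + u); have := hilbert_fun_dim P (e + u).
have := hilbert_fun_dim P u; have := dimv_sum_cap (mu @: fullv) W0.
have := dimvS sub1; have := dimvS sub2; rewrite !mu_dim -/W0 -/U0.
rewrite /reverse_coercion; lia.
Qed.

End HomogeneousMultiplication.

(** Some homogeneous component of an element of [Q] outside [P] is outside [P]. *)
Lemma homogeneous_witness P Q : ideal P -> homogeneous Q -> {subset P <= Q} ->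
  ~ {subset Q <= P} -> exists e, exists2 f, f \is e.-homog & f \in Q /\ f \notin P.
Proof.
move=> idP Qh sub nsub; apply: contrapT => no_f; apply: nsub => f fQ.
rewrite (pihomog_partitionE (mf := mdeg) (leqnn (msize f))); apply: ideal_sum => // d _.
apply: contrapT => /negP dP; apply: no_f; exists d, (pihomog mdeg d f); first exact: pihomogP.
by split; [apply: Qh|].
Qed.

(** By [hilbert_fun_drop] the polynomial of [Q] is bounded by the difference
between that of [P] and a translate of it. *)
Lemma hilbert_poly_drop P Q : prime_ideal P -> ideal Q -> homogeneous Q -> {subset P <= Q} ->
  ~ {subset Q <= P} -> hilbert_poly P != 0 ->
  (size (hilbert_poly Q) < size (hilbert_poly P))%N.
Proof.
move=> P_prime idQ Qh sub nsub p_neq0; have idP := ideal_prime P_prime.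
have [e [f fh [fQ fP]]] := homogeneous_witness idP Qh sub nsub.
apply: leq_ltn_trans (size_difference (- e%:R) p_neq0).
have cP := hilbert_polyP idP; have cQ := hilbert_polyP idQ.
apply: size_le_of_le (counts_ge0 cQ) _.
(* In degrees t >= e, apply the drop in degree e + (t - e). *)
have dropE : eventually (fun t => hilbert_fun Q t +
    (if (e <= t)%N then hilbert_fun P (t - e) else 0) <= hilbert_fun P t)%N.
  exists e => t le_et; rewrite le_et -{1 3}(subnKC le_et).
  exact: (hilbert_fun_drop _ fh P_prime idQ sub fQ fP).
apply: eventually_mono (eventuallyI (eventuallyI cQ cP) (eventuallyI (counts_delay e cP) dropE)).
move=> t [[QE PE] [PeE]]; rewrite hornerD hornerN QE PE PeE lerBrDr -natrD ler_nat.
by [].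
Qed.

(** If the polynomial vanished, [P] would contain all forms of some degree,
hence a power of each variable. *)
Lemma hilbert_poly_neq0 P : prime_ideal P -> (exists i, 'X_i \notin P) -> hilbert_poly P != 0.
Proof.
move=> P_prime [i /negP iP]; apply/eqP => p0; apply: iP; have idP := ideal_prime P_prime.
have [t /(_ _ (leqnn t))] := hilbert_polyP idP.
rewrite p0 horner0 => /esym/eqP; rewrite pnatr_eq0 => /eqP h0.
have full : graded_part P t = fullv.
  by apply/eqP; rewrite eqEdim subvf -(hilbert_fun_dim P t) h0 add0n leqnn.
apply: (@prime_ideal_exp _ _ t) => //.
have X1 : ('X_i : {mpoly F[n.+1]}) \is 1.-homog by rewrite dhomogX; apply/eqP/mdeg1.
have Xh := dhomogMn t X1; rewrite mul1n in Xh.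
have := memvf (DHomog Xh); rewrite -full mem_graded_part //.
Qed.

(** The sizes of the Hilbert polynomials decrease strictly along the chain and the
last one is positive. *)
Lemma proj_chain_le I c : ideal I -> proj_chain I c -> (c <= size (hilbert_poly I))%N.
Proof.
move=> idI [P [Ppt Pinc]].
have szP i : (i < c)%N -> (size (hilbert_poly (P i)) + i <= size (hilbert_poly I))%N.
  elim: i => [|i IH] lt_i.
    have [P_prime _ IP _] := Ppt _ lt_i.
    by rewrite addn0 size_hilbert_poly_le //; apply: ideal_prime.
  have [P_prime _ _ ntr] := Ppt _ (ltnW lt_i); have [Q_prime Qh _ _] := Ppt _ lt_i.
  have [sub nsub] := Pinc _ lt_i.
  apply: leq_trans (IH (ltnW lt_i)); rewrite addnS -addSn leq_add2r.
  by apply: hilbert_poly_drop => //; [apply: ideal_prime | apply: hilbert_poly_neq0].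
case: c Ppt szP {Pinc} => // c Ppt szP.
have [P_prime _ _ ntr] := Ppt c (leqnn _).
apply: leq_trans (szP c (leqnn _)); rewrite -[in X in (X <= _)%N]add1n leq_add2r.
by rewrite lt0n size_poly_eq0 hilbert_poly_neq0.
Qed.

Lemma proj_dim_chain I c : ideal I -> proj_chain I c -> c%:Z <= proj_dim I + 1.
Proof.
move=> idI chI; rewrite /proj_dim subrK lez_nat.
apply: (@ge_supremum_Nmem _ _ 0%N [set c | proj_chain I c]) => //.
apply: nat_supremums_neq0; exists (size (hilbert_poly I)) => b.
exact: proj_chain_le.
Qed.

Lemma proj_dim_le_hilbert I : ideal I -> proj_dim I + 1 <= (size (hilbert_poly I))%:Z.
Proof.
move=> idI; rewrite /proj_dim subrK lez_nat.
have ub : ubound [set c | proj_chain I c] (size (hilbert_poly I)).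
  by move=> b; apply: proj_chain_le.
have [s [ubs lbs]] : nonempty (supremums [set c | proj_chain I c]).
  by apply: nat_supremums_neq0; exists (size (hilbert_poly I)).
rewrite /supremum; case: ifP => // _; case: xgetP => // x _ [_]; apply.
exact: ub.
Qed.

End Ideals.

(** * Primes generated by variables *)

Section CoordinatePrimes.
Variables (n : nat) (F : fieldType).
Implicit Types (m : 'X_{1..n.+1}) (I P : {pred {mpoly F[n.+1]}}) (S T : {set 'I_n.+1}).

Lemma mcoeff_pihomog d (f : {mpoly F[n.+1]}) m :
  (pihomog mdeg d f)@_m = if mdeg m == d then f@_m else 0.
Proof.
rewrite pihomogE raddf_sum /=; case: eqP => [md|md].
  rewrite [in RHS](mpolyE f) raddf_sum big_mkcond; apply: eq_bigr => x _ /=.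
  rewrite mcoeffZ mcoeffX; case: (eqVneq x m) => [->|_]; first by rewrite md eqxx.
  by rewrite mulr0 if_same.
rewrite big1 // => x /eqP xd; rewrite mcoeffZ mcoeffX.
by case: (eqVneq x m) => [xm|_]; rewrite ?mulr0 //; rewrite xm in xd.
Qed.

Definition hits S m := [exists i in S, m i != 0%N].

Lemma hitsPn S m : reflect {in S, forall i, m i = 0%N} (~~ hits S m).
Proof.
rewrite negb_exists_in; apply: (iffP forall_inP) => h i /h;
  by rewrite ?negbK => /eqP.
Qed.

Lemma hits1 S i : hits S U_(i)%MM = (i \in S).
Proof.
apply/exists_inP/idP => [[j jS]|iS]; last by exists i; rewrite // mnm1E eqxx.
by rewrite mnm1E eqb0 negbK => /eqP ->.
Qed.

Lemma hitsS S T m : S \subset T -> hits S m -> hits T m.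
Proof. by move=> /fintype.subsetP ST /exists_inP[i /ST iT mi]; apply/exists_inP; exists i. Qed.

Definition coord_prime S : {pred {mpoly F[n.+1]}} := fun f => all (hits S) (msupp f).

Definition kill_coords S (f : {mpoly F[n.+1]}) : {mpoly F[n.+1]} :=
  f \mPo [tuple if i \in S then 0 else 'X_i | i < n.+1].

Lemma kill_coordsX S m : kill_coords S 'X_[m] = if hits S m then 0 else 'X_[m].
Proof.
rewrite /kill_coords comp_mpolyX; case: (boolP (hits S m)) => [/exists_inP[i iS mi]|/hitsPn S0].
  rewrite (bigD1 i) //= tnth_mktuple iS expr0n (negPf mi) mul0r //.
rewrite [RHS]mpolyXE_id; apply: eq_bigr => i _; rewrite tnth_mktuple.
by case: ifP => // /S0 ->; rewrite !expr0.
Qed.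

Lemma mcoeff_kill_coords S f m : (kill_coords S f)@_m = if hits S m then 0 else f@_m.
Proof.
have termE x : (f@_x *: kill_coords S 'X_[x])@_m = if hits S m then 0 else (f@_x *: 'X_[x])@_m.
  rewrite kill_coordsX !mcoeffZ mcoeffX; case: (eqVneq x m) => [->|xm].
    by case: ifP; rewrite ?mcoeff0 ?mulr0 // mcoeffX eqxx.
  by rewrite mulr0 if_same; case: ifP; rewrite ?mcoeff0 ?mcoeffX ?(negPf xm) mulr0.
rewrite [in RHS](mpolyE f) /kill_coords comp_mpolyEX !raddf_sum /= (eq_bigr _ (fun x _ => termE x)).
by case: ifP => // _; rewrite big1.
Qed.

(** The kernel of a ring morphism to an integral domain is prime; this description
serves to show that [coord_prime S] is. *)
Lemma mem_coord_prime S f : (f \in coord_prime S) = (kill_coords S f == 0).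
Proof.
apply/allP/eqP => [Sf|/mpolyP f0 m].
  apply/mpolyP => m; rewrite mcoeff_kill_coords mcoeff0.
  by case: ifPn => // Sm; apply: memN_msupp_eq0; apply: contra Sm; apply: Sf.
have := f0 m; rewrite mcoeff_kill_coords mcoeff0 mcoeff_msupp.
by case: ifP => // _ ->; rewrite eqxx.
Qed.

Lemma coord_prime_prime S : prime_ideal (coord_prime S).
Proof.
split; first split.
- by rewrite mem_coord_prime /kill_coords raddf0.
- by rewrite mem_coord_prime /kill_coords rmorph1 oner_eq0.
- move=> a u v; rewrite !mem_coord_prime /kill_coords rmorphD rmorphM /=.
  by move=> /eqP-> /eqP->; rewrite mulr0 addr0.
by move=> u v; rewrite !mem_coord_prime /kill_coords rmorphM mulf_eq0.
Qed.

Lemma coord_prime_ideal S : ideal (coord_prime S).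
Proof. exact/ideal_prime/coord_prime_prime. Qed.

Lemma coord_prime_homogeneous S : homogeneous (coord_prime S).
Proof.
move=> f /allP Sf d; apply/allP => m; rewrite mcoeff_msupp mcoeff_pihomog.
by case: ifP => [_|]; rewrite ?eqxx // -mcoeff_msupp; apply: Sf.
Qed.

Lemma coord_primeX S i : ('X_i \in coord_prime S) = (i \in S).
Proof. by rewrite /coord_prime /in_mem /= msuppX /= andbT hits1. Qed.

Lemma coord_primeS S T : S \subset T -> {subset coord_prime S <= coord_prime T}.
Proof. by move=> ST f /allP Sf; apply/allP => m /Sf; apply: hitsS. Qed.

(** Add the variables outside [S] one at a time, stopping before all are present. *)
Lemma coord_prime_chain I S : {subset I <= coord_prime S} -> proj_chain I #|~: S|.
Proof.
move=> IS; pose r := enum (~: S); pose T i := S :|: [set x in take i r].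
have size_r : size r = #|~: S| by rewrite -cardE.
have TS i : S \subset T i by apply: finset.subsetUl.
have newT i (x0 : 'I_n.+1) : (i < #|~: S|)%N -> nth x0 r i \notin T i.
  rewrite -size_r => lt_i; rewrite !inE negb_or.
  have -> : nth x0 r i \notin S by have := mem_nth x0 lt_i; rewrite mem_enum inE.
  rewrite -{1}(nth_take x0 (n0 := i.+1)) //.
  have : uniq (take i.+1 r) by rewrite take_uniq ?enum_uniq.
  by rewrite (take_nth x0) // rcons_uniq nth_rcons size_take lt_i ltnn eqxx => /andP[].
exists (fun i => coord_prime (T i)); split=> i lt_i.
  split; [exact: coord_prime_prime|exact: coord_prime_homogeneous| |].
    by move=> f /IS; apply: coord_primeS.
  by exists (nth ord0 r i); rewrite coord_primeX newT.
split=> [|sub].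
  apply: coord_primeS; apply: finset.setUS; apply/fintype.subsetP => x; rewrite !inE.
  by rewrite (take_nth ord0) ?size_r ?(ltnW lt_i) // mem_rcons inE => ->; rewrite orbT.
have := sub 'X_(nth ord0 r i); rewrite !coord_primeX (negPf (newT i _ (ltnW lt_i))).
rewrite !inE (take_nth ord0) ?size_r ?(ltnW lt_i) // mem_rcons inE eqxx orbT.
by move=> /(_ isT).
Qed.

Section MonomialIdeals.
Variables (I : {pred {mpoly F[n.+1]}}) (A : pred 'X_{1..n.+1}).
Hypothesis IA : forall f, (f \in I) = all A (msupp f).

Lemma leading_set_monomial le m : term_order le -> leading_set le I m = A m.
Proof.
move=> le_order; apply/asboolP/idP => [[f]|Am].
  by rewrite IA => /allP If [_ [mf _]]; apply: If.
exists 'X_[m]; first by rewrite IA msuppX /= Am.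
by rewrite dhomogX eqxx; split=> //; apply: leadingX.
Qed.

Lemma hilbert_fun_monomial t : ideal I -> hilbert_fun I t = count (predC A) (degree_mons n t).
Proof.
have [le le_order] := term_order_exists n; move=> idI.
rewrite (hilbert_fun_count le_order) //; apply: eq_count => m /=.
by rewrite leading_set_monomial.
Qed.

End MonomialIdeals.

Lemma hilbert_fun_coord_prime_le S t :
  (hilbert_fun (coord_prime S) t <= if #|~: S| is c.+1 then t.+1 ^ c else t == 0)%N.
Proof.
rewrite (@hilbert_fun_monomial _ (hits S)) //; last exact: coord_prime_ideal.
pose b := [seq i \notin S | i <- enum 'I_n.+1].
have sb : size b = n.+1 by rewrite size_map size_enum_ord.
have <- : count id b = #|~: S|.
  rewrite count_map -sum1_count big_enum_cond -sum1_card.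
  by apply: eq_bigl => i; rewrite !inE.
apply: leq_trans (count_avoids_le t sb).
rewrite count_map -!size_filter; apply: uniq_leq_size => [|s].
  by rewrite filter_uniq ?uniq_mons.
rewrite !mem_filter => /andP[/hitsPn S0 sn]; rewrite sn andbT.
move: sn; rewrite mem_mons => /andP[/eqP ss _].
rewrite /avoids all2E sb ss eqxx; apply/(all_nthP (false, 0%N)) => i.
rewrite size_zip sb ss minnn nth_zip ?sb ?ss //= => lt_i.
rewrite (nth_map ord0) ?size_enum_ord //.
have := S0 (nth ord0 (enum 'I_n.+1) i); rewrite mnmE nth_enum_ord //.
by case: (_ \in S) => //= ->.
Qed.

Lemma size_hilbert_poly_coord_prime_le S :
  (size (hilbert_poly (coord_prime S)) <= #|~: S|)%N.
Proof.
have cS := hilbert_polyP (coord_prime_ideal S).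
case: #|~: S| (hilbert_fun_coord_prime_le S) => [|c] leS.
  rewrite -(size_poly0 rat); apply: (@size_counts_le _ (fun=> 0%N)) cS _ _.
    by exists 0%N => t _; rewrite horner0.
  by exists 1%N => -[] // t _; apply: leS.
have <- : size (('X + 1%:P) ^+ c : {poly rat}) = c.+1.
  by rewrite -[1%:P]opprK -polyCN size_exp_XsubC.
apply: (@size_counts_le _ (fun t => t.+1 ^ c)%N) cS _ _; last by exists 0%N.
by exists 0%N => t _; rewrite horner_exp !hornerE natrX -natr1.
Qed.

Lemma card_le_proj_dim I S : ideal I -> {subset I <= coord_prime S} ->
  (#|~: S|)%:Z <= proj_dim I + 1.
Proof. by move=> idI /coord_prime_chain; apply: proj_dim_chain. Qed.

(** The lower bound comes from the chain of primes, which spares the explicit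
Hilbert polynomial. *)
Lemma size_hilbert_poly_coord_prime S : size (hilbert_poly (coord_prime S)) = #|~: S|.
Proof.
apply/eqP; rewrite eqn_leq size_hilbert_poly_coord_prime_le -lez_nat.
apply: le_trans (proj_dim_le_hilbert (coord_prime_ideal S)).
exact: card_le_proj_dim (coord_prime_ideal S) _.
Qed.

Lemma proj_dim_coord_prime S : proj_dim (coord_prime S) + 1 = (#|~: S|)%:Z.
Proof.
apply/eqP; rewrite eq_le card_le_proj_dim //; last exact: coord_prime_ideal.
by rewrite -size_hilbert_poly_coord_prime proj_dim_le_hilbert //; apply: coord_prime_ideal.
Qed.

End CoordinatePrimes.

(** * Square-free monomial ideals *)

Section SquarefreeIdeals.
Variables (n : nat) (F : fieldType) (T : finType) (e : T -> 'X_{1..n.+1}).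
Implicit Types (m : 'X_{1..n.+1}) (S : {set 'I_n.+1}).

Definition multiples m := [exists i, (e i <= m)%MM].

Definition monomial_ideal : {pred {mpoly F[n.+1]}} :=
  ideal_gen (fun h => exists i, h = 'X_[e i]).

Lemma mem_monomial_ideal f : (f \in monomial_ideal) = all multiples (msupp f).
Proof.
have idJ : ideal monomial_ideal by apply: ideal_gen_ideal.
apply/idP/allP => [/asboolP[s [sG ->]] m|Af].
  move=> /msupp_sum_le/flatten_mapP[ag]; rewrite mem_filter /= => /sG[i ->].
  rewrite (perm_mem (msuppMX _ _)) => /mapP[m' _ ->].
  by apply/existsP; exists i; apply: lem_addr.
rewrite (mpolyE f) big_seq; apply: ideal_sum => // m /Af/existsP[i le_im].
rewrite -(submK le_im) mpolyXD scalerAl idealM //.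
by apply: mem_ideal_gen; exists i.
Qed.

Definition cover_set S := [forall i, hits S (e i)].

Lemma monomial_ideal_sub S : cover_set S -> {subset monomial_ideal <= coord_prime S}.
Proof.
move=> /forallP eS; apply: ideal_genP; first exact: coord_prime_ideal.
by move=> _ [i ->]; rewrite /coord_prime /in_mem /= msuppX /= eS.
Qed.

Lemma prime_monomial P m : prime_ideal P -> 'X_[F, m] \in P -> exists2 i, m i != 0%N & 'X_i \in P.
Proof.
move=> P_prime; rewrite mpolyXE_id => Pm; apply: contrapT => no_i.
have : \prod_(i < n.+1) 'X_i ^+ m i \notin P; last by rewrite Pm.
have [[_ P1 _] Pmul] := P_prime.
apply: (big_ind (fun f => f \notin P)) => // [x y xP yP|i _].
  by apply/negP => /Pmul; rewrite (negPf xP) (negPf yP).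
apply/negP => iP; apply: no_i; exists i; last exact: prime_ideal_exp iP.
by apply: contraNneq P1 => mi0; move: iP; rewrite mi0 expr0.
Qed.

(** A prime containing a monomial contains one of its variables, so the variables
in a prime over the monomial ideal form a cover. *)
Lemma minimal_prime_cover S : minset cover_set S -> minimal_prime monomial_ideal (coord_prime S).
Proof.
move=> /minsetP[covS minS]; split; [exact: coord_prime_prime|exact: monomial_ideal_sub|].
move=> Q Q_prime JQ QS; pose S' := [set i | 'X_i \in Q].
have covS' : cover_set S'.
  apply/forallP => i; have : 'X_[e i] \in Q by apply/JQ/mem_ideal_gen; exists i.
  move=> /(prime_monomial Q_prime)[j ej jQ].
  by apply/exists_inP; exists j; rewrite ?inE.
have S'S : S' \subset S.
  by apply/fintype.subsetP => i; rewrite inE => /QS; rewrite coord_primeX.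
have S'E := minS _ covS' S'S.
have idQ := ideal_prime Q_prime.
move=> f /allP Sf; rewrite (mpolyE f) big_seq; apply: ideal_sum => // m /Sf.
rewrite -S'E => /exists_inP[i iQ mi]; rewrite inE in iQ.
have le_im : (U_(i) <= m)%MM by rewrite lep1mP.
by rewrite -(submK le_im) mpolyXD scalerAl idealM.
Qed.

Hypothesis squarefree : forall i j, (e i j <= 1)%N.

(** The variables not dividing [m] form a cover: by square-freeness, a generator in
the other variables only would divide [m]. *)
Lemma cover_avoiding m : ~~ multiples m -> exists2 S, minset cover_set S & ~~ hits S m.
Proof.
move=> Am; pose S0 := [set i | m i == 0%N].
have covS0 : cover_set S0.
  apply/forallP => i; apply: contraNT Am => /hitsPn S0e; apply/existsP; exists i.
  apply/mnm_lepP => j; have [mj|mj] := eqVneq (m j) 0%N.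
    by rewrite S0e // inE mj.
  by apply: leq_trans (squarefree i j) _; rewrite lt0n.
have [S minS sub] := minset_exists covS0.
exists S => //; apply: contra (hitsS sub) _; apply/hitsPn => i.
by rewrite inE => /eqP.
Qed.

Lemma count_le_sum (X : Type) (Y : finType) (p : pred X) (B : pred Y) (q : Y -> pred X) (l : seq X) :
  (forall x, p x -> exists2 y, B y & q y x) ->
  (count p l <= \sum_(y | B y) count (q y) l)%N.
Proof.
move=> pq; elim: l => //= x l IH; rewrite big_split leq_add //=.
by case: (boolP (p x)) => // /pq[y By qyx]; rewrite (bigD1 y) //= qyx.
Qed.

(** A monomial outside the ideal lies outside one of the minimal primes, so the
Hilbert function is at most the sum of theirs. *)
Lemma size_hilbert_poly_monomial c :
  (forall S, minset cover_set S -> #|~: S| = c) ->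
  (size (hilbert_poly monomial_ideal) <= c)%N.
Proof.
move=> cE; have idJ : ideal monomial_ideal by apply: ideal_gen_ideal.
have sumE t : (hilbert_fun monomial_ideal t <=
    \sum_(S | minset cover_set S) hilbert_fun (coord_prime (F := F) S) t)%N.
  rewrite (hilbert_fun_monomial mem_monomial_ideal) //.
  rewrite (eq_bigr (fun S => count (predC (hits S)) (degree_mons n t))) => [|S _].
    by apply: count_le_sum => m; apply: cover_avoiding.
  by rewrite (@hilbert_fun_monomial _ _ _ (hits S)) //; apply: coord_prime_ideal.
have sum_counts (r : seq {set 'I_n.+1}) : exists2 p,
    counts (fun t => \sum_(S <- r | minset cover_set S) hilbert_fun (coord_prime (F := F) S) t)%N p
    & (size p <= c)%N.
  elim: r => [|S r [p pP sp]].
    by exists 0; [exists 0%N => t _; rewrite big_nil horner0 | rewrite size_poly0].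
  have [minS|nminS] := boolP (minset cover_set S); last first.
    by exists p => //; apply: counts_eq pP; exists 0%N => t _; rewrite big_cons (negPf nminS).
  exists (hilbert_poly (coord_prime (F := F) S) + p).
    apply: counts_eq (countsD (hilbert_polyP (coord_prime_ideal F S)) pP).
    by exists 0%N => t _; rewrite big_cons minS.
  by rewrite (leq_trans (size_polyD _ _)) // geq_max sp size_hilbert_poly_coord_prime cE ?leqnn.
have [p pP sp] := sum_counts (index_enum _).
apply: leq_trans sp; apply: size_counts_le (hilbert_polyP idJ) pP _.
by exists 0%N => t _; apply: sumE.
Qed.

End SquarefreeIdeals.

(** * Leading monomials of a homogeneous ideal *)

Section InitialIdeal.
Variables (n : nat) (F : fieldType) (le : rel 'X_{1..n.+1}).
Hypothesis le_order : term_order le.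
Implicit Types (m : 'X_{1..n.+1}).

Lemma init_monP (f : {mpoly F[n.+1]}) : f != 0 -> exists2 m, init_mon le f = 'X_[m] & leading le f m.
Proof.
have [tot _ trans _ _] := le_order.
move=> f0; rewrite /init_mon (negPf f0).
exists (last 0%MM (sort le (msupp f))) => //.
have fS : sort le (msupp f) =i msupp f by apply: mem_sort.
have : sorted le (sort le (msupp f)) by apply: sort_sorted.
have : sort le (msupp f) != [::] by rewrite -size_eq0 size_sort size_eq0 msupp_eq0.
rewrite /leading -(fS (last _ _)).
case/lastP: (sort le (msupp f)) fS => // s x fS _.
rewrite sorted_pairwise // pairwise_rcons last_rcons => /andP[/allP s_x _].
split=> [|m']; first by rewrite mem_rcons mem_head.
rewrite -fS mem_rcons inE => /predU1P[->|/s_x //].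
by have := tot x x; rewrite orbb.
Qed.

(** The component of [f] in the degree of its leading monomial has the same leading
monomial.  This holds for an arbitrary term order, which need not refine the
degree. *)
Lemma leading_set_homogeneous (I : {pred {mpoly F[n.+1]}}) f m : homogeneous I ->
  f \in I -> leading le f m -> leading_set le I m.
Proof.
move=> I_homog fI [mf lef]; apply/asboolP; exists (pihomog mdeg (mdeg m) f).
  exact: I_homog.
split; first exact: pihomogP.
split=> [|m']; rewrite mcoeff_msupp mcoeff_pihomog.
  by rewrite eqxx -mcoeff_msupp.
by case: ifP; rewrite ?eqxx // -mcoeff_msupp => _; apply: lef.
Qed.

Lemma leading_set0 (I : {pred {mpoly F[n.+1]}}) : prime_ideal I -> ~~ leading_set le I 0%MM.
Proof.
move=> I_prime; have idI := ideal_prime I_prime; have [[_ I1 _] _] := I_prime.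
apply/asboolP => -[f fI [fh [f0 _]]]; move: fh f0; rewrite mdeg0 mcoeff_msupp => fh f0.
have fE : f = (f@_0%MM)%:MP.
  apply/mpolyP => m; rewrite mcoeffC; case: (eqVneq 0%MM m) => [<-|m0]; first by rewrite mulr1.
  by rewrite mulr0 (dhomog_nemf_coeff fh) // mdeg_eq0 eq_sym.
move: I1; have -> : 1 = (f@_0%MM)^-1 *: f by rewrite {2}fE -mul_mpolyC -mpolyCM mulVf.
by rewrite idealZ.
Qed.

End InitialIdeal.

(** * Comparison of the two Hilbert polynomials *)

Section DegreeComparison.
Variables (n : nat) (F : fieldType) (le : rel 'X_{1..n.+1}).
Hypothesis le_order : term_order le.
Variables (T : finType) (e : T -> 'X_{1..n.+1}) (I : {pred {mpoly F[n.+1]}}).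
Hypothesis idI : ideal I.
Hypothesis sub_lead : forall m, multiples e m -> leading_set le I m.

Local Notation J := (monomial_ideal (F := F) e).

(** The products of [a] with the monomials avoiding [S] are leading monomials of
[I] that are not multiples of any [e i], since each [e i] involves a variable
of [S]. *)
Lemma hilbert_fun_gap a (S : {set 'I_n.+1}) t : leading_set le I a -> cover_set e S -> ~~ hits S a ->
  (hilbert_fun I t + (if mdeg a <= t then hilbert_fun (coord_prime (F := F) S) (t - mdeg a) else 0)
     <= hilbert_fun J t)%N.
Proof.
move=> Ia covS Sa; have idJ : ideal J by apply: ideal_gen_ideal.
have idS := coord_prime_ideal F S.
have -> := hilbert_fun_count le_order t idI.
have -> := hilbert_fun_monomial (@mem_monomial_ideal _ F _ e) t idJ.
have -> := @hilbert_fun_monomial _ F _ (hits S) (fun=> erefl) (t - mdeg a) idS.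
set L := degree_mons n t.
have gap : ((if mdeg a <= t then count (predC (hits S)) (degree_mons n (t - mdeg a)) else 0)
    <= count (predI (leading_set le I) (predC (multiples e))) L)%N.
  case: (leqP (mdeg a) t) => // le_at; rewrite -!size_filter -(size_map (mnm_add a)).
  apply: uniq_leq_size => [|x /mapP[m m_in ->]].
    by rewrite map_inj_uniq ?filter_uniq ?uniq_degree_mons // => x y /addmI.
  move: m_in; rewrite !mem_filter !mem_degree_mons => /andP[/hitsPn Sm /eqP mt].
  rewrite mdegD mt subnKC // eqxx andbT /= leading_set_mul //=.
  apply/existsP => -[i /mnm_lepP le_i].
  have /exists_inP[j jS] := forallP covS i.
  have := le_i j; rewrite mnmDE Sm // addn0 (hitsPn S a Sa) // leqn0 => /eqP ->.
  by rewrite eqxx.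
apply: leq_trans (leq_add (leqnn _) gap) _.
rewrite -count_predUI addnC.
rewrite (@eq_count _ (predI _ _) pred0) ?count_pred0 => [|m /=]; last by case: leading_set.
apply: sub_count => m /=; case: (boolP (leading_set le I m)) => //= Im _.
by apply: contra Im; apply: sub_lead.
Qed.

End DegreeComparison.

(** The contradiction is between [gap], which makes the difference of the two
Hilbert polynomials dominate a polynomial of size [s], and the cancellation of
their leading terms, which makes its size smaller than [s]. *)
Lemma leading_set_generated (n : nat) (F : fieldType) (le : rel 'X_{1..n.+1})
    (I : {pred {mpoly F[n.+1]}}) (T : finType) (e : T -> 'X_{1..n.+1}) :
  term_order le -> prime_ideal I -> (forall i j, (e i j <= 1)%N) ->
  (forall i, leading_set le I (e i)) ->
  equidimensional (monomial_ideal (F := F) e) ->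
  proj_dim (monomial_ideal (F := F) e) = proj_dim I ->
  proj_deg (monomial_ideal (F := F) e) = proj_deg I ->
  forall m, leading_set le I m -> multiples e m.
Proof.
set J := monomial_ideal (F := F) e => le_order I_prime sqf lead_e eqdim dimE degE a Ia.
have idI := ideal_prime I_prime; have idJ : ideal J by apply: ideal_gen_ideal.
have sub_lead m : multiples e m -> leading_set le I m.
  by move=> /existsP[i le_i]; rewrite -(submK le_i) addmC leading_set_mul.
apply: contraT => /(cover_avoiding sqf)[S minS Sa].
have covS : cover_set e S by case/minsetP: minS.
pose s := #|~: S|; pose hpS := hilbert_poly (coord_prime (F := F) S).
pose q := hpS \Po ('X + (- (mdeg a)%:R)%:P).
have size_q : size q = s by rewrite size_shift /hpS size_hilbert_poly_coord_prime.
(* If S were everything then a = 1, which is not a leading monomial of a proper ideal. *)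
have s_gt0 : (0 < s)%N.
  rewrite lt0n cards_eq0; apply/eqP => S0; move: Ia; apply/negP.
  suff -> : a = 0%MM by apply: leading_set0.
  apply/mnmP => i; rewrite mnm0E (hitsPn S a Sa) //.
  apply: contraT => iS; have : i \in ~: S by rewrite inE.
  by rewrite S0 inE.
have cI := hilbert_polyP idI; have cJ := hilbert_polyP idJ.
have cS := hilbert_polyP (coord_prime_ideal F S).
have sizeJ : (size (hilbert_poly J) <= s)%N.
  apply: (@size_hilbert_poly_monomial n F T e sqf s) => S' minS'.
  apply/eqP; rewrite -eqz_nat -!(proj_dim_coord_prime F); apply/eqP; congr (_ + 1).
  by apply: eqdim; apply: minimal_prime_cover.
have gap := hilbert_fun_gap le_order idI sub_lead _ Ia covS Sa.
have sizeIJ : (size (hilbert_poly I) <= size (hilbert_poly J))%N.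
  apply: size_counts_le cI cJ _; exists 0%N => t _.
  exact: leq_trans (leq_addr _ _) (gap t).
(* Chains of primes over J give s <= dim J + 1 = dim I + 1. *)
have sizeI : (s <= size (hilbert_poly I))%N.
  rewrite -lez_nat; apply: le_trans (proj_dim_le_hilbert idI); rewrite -dimE.
  by apply: card_le_proj_dim => //; apply: monomial_ideal_sub.
have sizeIE : size (hilbert_poly I) = size (hilbert_poly J).
  by apply/eqP; rewrite eqn_leq sizeIJ (leq_trans sizeJ).
have sizeJE : size (hilbert_poly J) = s.
  by apply/eqP; rewrite eqn_leq sizeJ -sizeIE.
have leadE : lead_coef (hilbert_poly I) = lead_coef (hilbert_poly J).
  move: degE; rewrite /proj_deg dimE => /(mulfI _) -> //.
  by rewrite pnatr_eq0 -lt0n fact_gt0.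
have J_neq0 : hilbert_poly J != 0 by rewrite -size_poly_eq0 sizeJE -lt0n.
have := size_sub_lt J_neq0 sizeIE leadE; rewrite sizeJE -size_q ltnNge => /negP; case.
have cq := counts_delay (mdeg a) cS.
apply: size_le_of_le (counts_ge0 cq) _.
apply: eventually_mono (eventuallyI (eventuallyI cI cJ) cq) => t [[IE JE]].
rewrite -/q hornerD hornerN IE JE => ->.
by rewrite lerBrDl -natrD ler_nat; apply: gap.
Qed.

Theorem lemma3p1 (R : realType) (n : nat)
  (I : {pred {mpoly (complex R)[n.+1]}})
  (I_prime : prime_ideal I) (I_homog : homogeneous I)
  (k : nat) (g : 'I_k -> {mpoly (complex R)[n.+1]})
  (gI : forall i, g i \in I)
  (le : rel 'X_{1..n.+1}) (le_order : term_order le) :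
  let J := ideal_gen (fun h => exists i, h = init_mon le (g i)) in
  (forall i, squarefree_mon (init_mon le (g i))) ->
  equidimensional J ->
  proj_dim J = proj_dim I ->
  proj_deg J = proj_deg I ->
  groebner_basis le I (fun f => exists i, f = g i).
Proof.
move=> J sqf.
have /boolp.choice[e eP] : forall i, exists m, [/\ init_mon le (g i) = 'X_[m],
    leading le (g i) m & forall j, (m j <= 1)%N].
  move=> i; have [m initE m_le1] := sqf i; exists m.
  have g_neq0 : g i != 0.
    apply: contra_eq_neq initE => ->; rewrite /init_mon eqxx eq_sym.
    by rewrite -msupp_eq0 msuppX.
  have [m' initE' lead] := init_monP le_order g_neq0.
  suff mE : m = m' by split=> //; rewrite mE.
  have : m \in msupp ('X_[m'] : {mpoly (complex R)[n.+1]}) by rewrite -initE' initE msuppX mem_head.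
  by rewrite msuppX inE => /eqP.
have idI := ideal_prime I_prime.
have JE : J = monomial_ideal (F := complex R) e.
  rewrite /J /monomial_ideal; congr ideal_gen; apply: funext => h; apply: propext.
  by split=> -[i ->]; exists i; have [-> _ _] := eP i.
rewrite JE => eqdim dimE degE; split=> [_ [i ->]|]; first exact: gI.
have genI := leading_set_generated le_order I_prime _ _ eqdim dimE degE.
move=> f; apply/idP/idP; apply: ideal_genP; try exact: ideal_gen_ideal.
  move=> _ [_ [i ->] ->]; apply: mem_ideal_gen.
  by exists (g i); [exact: gI|].
move=> _ [h hI ->]; have [->|h_neq0] := eqVneq h 0.
  by rewrite /init_mon eqxx; case: (ideal_gen_ideal (fun h => exists2 f, (exists i, f = g i) & h = init_mon le f)).
have [m -> lead] := init_monP le_order h_neq0.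
have /existsP[i le_i] : multiples e m.
  apply: genI; last exact: (leading_set_homogeneous I_homog hI lead).
    by move=> i j; have [_ _] := eP i; apply.
  by move=> i; have [_ lead_i _] := eP i; apply: (leading_set_homogeneous I_homog (gI i)).
rewrite -(submK le_i) mpolyXD; apply: idealM; first exact: ideal_gen_ideal.
apply: mem_ideal_gen; exists (g i); first by exists i.
by have [-> _ _] := eP i.
Qed.
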